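(* Let $X$ be a non-zero real normed linear space. Then $(\frac12, x)$ has the order unit property in $\widetilde{X}$ for every $x \in X$ with $\|x\| = \frac12$ if and only if $X$ is strictly convex.
   Context: $\widetilde{X} := \mathbb{R} \oplus_1 X$, i.e. $\mathbb{R}\times X$ with norm $\|(\alpha, x)\| = |\alpha| + \|x\|$, with the cone $\widetilde{X}^+ := \{(\alpha, x) \in \widetilde{X} : \|x\| \le \alpha\}$ and $e := (1,0)$. Then $(\widetilde{X}, e)$ is an order unit space (Archimedean ordered vector space with order unit $e$) whose order unit norm $\inf\{k>0 : ke \pm v \in \widetilde{X}^+\}$ is the given norm. For an order unit space $(V,e)$ with order unit norm $\|\cdot\|$, $u \in V^+$ has the order unit property (OUP) in $V$ if, for every $v \in V$, $\|v\| u \pm v \in V^+$ whenever $\lambda u \pm v \in V^+$ for some real $\lambda > 0$. *)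

(* Defs.v *)
From HB Require Import structures.
From mathcomp Require Import all_boot all_order all_algebra.
From mathcomp Require Import all_classical all_reals all_analysis.
From mathcomp Require Import ring lra.

Set Implicit Arguments.
Unset Strict Implicit.
Unset Printing Implicit Defensive.

Import Order.TTheory GRing.Theory Num.Theory.
Import numFieldNormedType.Exports.

Local Open Scope classical_set_scope.
Local Open Scope ring_scope.

Definition pm_in (R : realType) (V : lmodType R) (C : set V) (a v : V) : Prop :=
  C (a + v) /\ C (a - v).

(* The order is given by its positive cone: [v <= w] iff [ous_cone (w - v)]. *)
Record orderUnitSpace (R : realType) := OrderUnitSpace {
  ous_sort :> lmodType R;
  ous_cone : set ous_sort;
  ous_unit : ous_sort;
  ous_coneD : forall v w, ous_cone v -> ous_cone w -> ous_cone (v + w);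
  ous_coneZ : forall (k : R) v, 0 <= k -> ous_cone v -> ous_cone (k *: v);
  ous_cone_proper : forall v, ous_cone v -> ous_cone (- v) -> v = 0;
  ous_unit_cone : ous_cone ous_unit;
  ous_unit_order : forall v,
    exists2 k : R, 0 < k & pm_in ous_cone (k *: ous_unit) v;
  ous_archimedean : forall v,
    (forall k : R, 0 < k -> ous_cone (k *: ous_unit + v)) -> ous_cone v
}.

Definition ou_norm (R : realType) (V : orderUnitSpace R) (v : V) : R :=
  inf [set k : R | 0 < k /\ pm_in (@ous_cone R V) (k *: ous_unit V) v].

Definition order_unit_property (R : realType) (V : orderUnitSpace R) (u : V)
    : Prop :=
  ous_cone u /\
  forall v : V,
    (exists2 l : R, 0 < l & pm_in (@ous_cone R V) (l *: u) v) ->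
    pm_in (@ous_cone R V) (ou_norm v *: u) v.

Section Tilde.
Variables (R : realType) (X : normedModType R).

(* Only the vector space structure of the library product is used: its own
   norm is the sup norm, not the l1 norm below. *)
Definition tilde_vect : lmodType R := (R^o * X)%type.

Definition tilde_cone : set tilde_vect := [set v | `|v.2| <= v.1].

Definition tilde_unit : tilde_vect := (1, 0).

Definition l1_norm (v : tilde_vect) : R := `|v.1| + `|v.2|.

Lemma tilde_pm_in (k : R) (v : tilde_vect) :
  pm_in tilde_cone (k *: tilde_unit) v <-> l1_norm v <= k.
Proof.
case: v => a x; rewrite /pm_in /tilde_cone /l1_norm /=.
have -> : k *: (1 : R^o) = k by rewrite /GRing.scale /= mulr1.
rewrite scaler0 add0r sub0r normrN; split.
  by move=> [h1 h2]; case: (ger0P a) => ha; lra.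
by move=> h; split; move: h; case: (ger0P a) => ha; lra.
Qed.

Lemma tilde_coneD v w : tilde_cone v -> tilde_cone w -> tilde_cone (v + w).
Proof.
by move=> hv hw; apply: le_trans (ler_normD _ _) _; apply: lerD.
Qed.

Lemma tilde_coneZ (k : R) v : 0 <= k -> tilde_cone v -> tilde_cone (k *: v).
Proof.
move=> k0 hv; rewrite /tilde_cone /= normrZ (ger0_norm k0).
exact: ler_wpM2l.
Qed.

Lemma tilde_cone_proper v : tilde_cone v -> tilde_cone (- v) -> v = 0.
Proof.
case: v => a x; rewrite /tilde_cone /= normrN => h1 h2.
have x0 : `|x| = 0 by have := normr_ge0 x; lra.
have a0 : a = 0 by lra.
by rewrite a0 (normr0_eq0 x0).
Qed.

Lemma tilde_unit_cone : tilde_cone tilde_unit.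
Proof. by rewrite /tilde_cone /= normr0. Qed.

Lemma tilde_unit_order v :
  exists2 k : R, 0 < k & pm_in tilde_cone (k *: tilde_unit) v.
Proof.
exists (l1_norm v + 1); last by apply/tilde_pm_in; rewrite lerDl.
by rewrite /l1_norm ltr_wpDl ?addr_ge0.
Qed.

Lemma tilde_archimedean v :
  (forall k : R, 0 < k -> tilde_cone (k *: tilde_unit + v)) -> tilde_cone v.
Proof.
case: v => a x h; apply/ler_addgt0Pl => k k0.
have := h _ k0; rewrite /tilde_cone /= scaler0 add0r.
by rewrite /GRing.scale /= mulr1.
Qed.

Definition tilde : orderUnitSpace R :=
  OrderUnitSpace tilde_coneD tilde_coneZ tilde_cone_proper tilde_unit_cone
    tilde_unit_order tilde_archimedean.

Lemma ou_norm_tilde (v : tilde) : ou_norm v = l1_norm v.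
Proof.
rewrite /ou_norm.
set S := (X in inf X).
have SE k : S k <-> 0 < k /\ l1_norm v <= k.
  by split => -[k0 /tilde_pm_in hk].
have n0 : 0 <= l1_norm v by rewrite addr_ge0.
have lbS : lbound S (l1_norm v) by move=> k /SE[].
have S0 : S !=set0.
  by exists (l1_norm v + 1); apply/SE; rewrite ltr_wpDl // lerDl.
apply/eqP; rewrite eq_le (lb_le_inf S0 lbS) andbT.
apply/ler_addgt0Pr => k k0.
apply: ge_inf; first by exists (l1_norm v).
by apply/SE; rewrite ltr_wpDl // lerDl ltW.
Qed.

End Tilde.

Definition strictly_convex (R : realType) (X : normedModType R) : Prop :=
  forall x y : X, `|x| = 1 -> `|y| = 1 -> x != y -> `|2^-1 *: (x + y)| < 1.

(* Main.v *)
Require Import Defs.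
From mathcomp Require Import all_boot all_order all_algebra.
From mathcomp Require Import all_classical all_reals all_analysis.
From mathcomp Require Import ring lra.

Import Order.TTheory GRing.Theory Num.Theory.
Import numFieldNormedType.Exports.

Local Open Scope ring_scope.

(** Write [u = (1/2, x)] with [`|x| = 1/2], a point on the boundary of the
    cone.  The key remark is that [l *: u + v] and [l *: u - v] both lie in the
    cone, for [v = (a, y)], exactly when
      [`|l *: x + y| <= l / 2 + a]  and  [`|l *: x - y| <= l / 2 - a];
    the two right-hand sides add up to [l = `|2 *: (l *: x)|], so the triangle
    inequality forces equality everywhere.

    If the space is strictly convex, equality in the triangle inequality makes
    the two vectors lie on a common ray ([ler_normD_eq_collinear]), so that
    [y = 2 * a *: x], i.e. [v = 2 * a *: u]: the face of the cone through [u]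
    is a ray ([tilde_boundary_ray]).  On a ray the order unit property is
    immediate, as the order unit norm of [2 * a *: u] is [2 * `|a|].

    Conversely, if the midpoint of two unit vectors [x] and [y] has norm at
    least 1, it has norm 1, and [u = (1/2, (x + y) / 4)] is the midpoint of
    [p = (1/2, x / 2)] and [q = (1/2, y / 2)].  Now [2 *: u - p = q] lies in
    the cone and [p] has norm 1, so the order unit property puts
    [u - p = (0, (y - x) / 4)] in the cone, whence [x = y]. *)

(** Scaled by the smaller norm, the sum of the two normalised vectors is
    strictly shorter than it should be unless they coincide, and the remainder
    of the longer vector cannot make up for the loss. *)
Lemma ler_normD_eq_collinear (R : realType) (X : normedModType R) (p q : X) :
  strictly_convex X -> `|p + q| = `|p| + `|q| -> `|q| *: p = `|p| *: q.
Proof.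
move=> scX; wlog le_pq : p q / `|p| <= `|q|.
  move=> H; case: (leP `|p| `|q|) => [|/ltW] le_pq eq_pq; first exact: H.
  by apply/esym/H => //; rewrite addrC eq_pq addrC.
move=> eq_pq; have [->|p0] := eqVneq p 0; first by rewrite normr0 scaler0 scale0r.
have p_gt0 : 0 < `|p| by rewrite normr_gt0.
have q_gt0 : 0 < `|q| by exact: lt_le_trans le_pq.
set x := `|p|^-1 *: p; set y := `|q|^-1 *: q.
have px : p = `|p| *: x by rewrite scalerA mulfV ?scale1r // gt_eqF.
have qy : q = `|q| *: y by rewrite scalerA mulfV ?scale1r // gt_eqF.
have x1 : `|x| = 1 by rewrite normrZ gtr0_norm ?invr_gt0 // mulVf // gt_eqF.
have y1 : `|y| = 1 by rewrite normrZ gtr0_norm ?invr_gt0 // mulVf // gt_eqF.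
(* Generalising over [x] and [y] hides that they are multiples of [p] and
   [q], so that rewriting with [scalerA] leaves them alone. *)
move: x y px qy x1 y1 => x y px qy x1 y1.
have [xy|/(scX _ _ x1 y1)] := eqVneq x y.
  by rewrite [in LHS]px [in RHS]qy xy !scalerA mulrC.
rewrite normrZ gtr0_norm ?invr_gt0 ?ltr0n // => lt_xy; exfalso.
have splitE : p + q = `|p| *: (x + y) + (`|q| - `|p|) *: y.
  by rewrite [in LHS]px [in LHS]qy scalerDr scalerBl -addrA [_ + (_ - _)]addrC subrK.
have := ler_normD (`|p| *: (x + y)) ((`|q| - `|p|) *: y).
rewrite -splitE eq_pq !normrZ y1 mulr1 normr_id ger0_norm ?subr_ge0 //.
have : `|p| * `|x + y| < `|p| * 2 by rewrite ltr_pM2l //; lra.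
lra.
Qed.

(** Domination by a multiple of the boundary point [(1/2, x)] leaves no slack
    in the triangle inequality for [l *: x + y] and [l *: x - y], whose sum has
    norm exactly [l]; both are then multiples of [x].  The factor is read off
    from the first coordinate, since that of the boundary point is [1/2]. *)
Lemma tilde_boundary_ray (R : realType) (X : normedModType R) (x : X) (l : R)
    (v : tilde X) :
  strictly_convex X -> `|x| = 2^-1 -> 0 < l ->
  pm_in (@tilde_cone R X) (l *: ((2^-1 : R, x) : tilde_vect X)) v ->
  v = (2 * v.1) *: ((2^-1 : R, x) : tilde_vect X).
Proof.
case: v => a y scX x2 l0 [].
rewrite /tilde_cone /= => h1 h2.
have {}h1 : `|l *: x + y| <= l * 2^-1 + a := h1.
have {}h2 : `|l *: x - y| <= l * 2^-1 - a := h2.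
have sumE : (l *: x + y) + (l *: x - y) = (2 * l) *: x.
  by rewrite addrACA subrr addr0 -scalerDl mulr_natl mulr2n.
have normE : `|(l *: x + y) + (l *: x - y)| = l.
  by rewrite sumE normrZ x2 gtr0_norm ?mulr_gt0 //; field.
have tri := ler_normD (l *: x + y) (l *: x - y); rewrite normE in tri.
have e1 : `|l *: x + y| = l * 2^-1 + a by lra.
have e2 : `|l *: x - y| = l * 2^-1 - a by lra.
have := @ler_normD_eq_collinear _ _ (l *: x + y) (l *: x - y) scX.
rewrite normE e1 e2 => /(_ ltac:(lra)) col.
(* By [ler_normD_eq_collinear], a vector times the sum of the two norms is its
   own norm times the sum of the two vectors; the former sum is [l]. *)
have lpE : l *: (l *: x + y) = l *: ((l + 2 * a) *: x).
  have -> : l *: (l *: x + y) = (l * 2^-1 - a) *: (l *: x + y)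
      + (l * 2^-1 + a) *: (l *: x + y) by rewrite -scalerDl; congr (_ *: _); lra.
  by rewrite col -scalerDr [_ - y + _]addrC sumE !scalerA; congr (_ *: _); field.
have /(scalerI (lt0r_neq0 l0)) := lpE.
rewrite scalerDl => /addrI yE.
congr pair; last exact: yE.
by change (a = 2 * a * 2^-1); field.
Qed.

Theorem proposition5p4 (R : realType) (X : normedModType R)
    (X_nonzero : exists x : X, x != 0) :
  (forall x : X, `|x| = 2^-1 ->
     @order_unit_property R (tilde X) (2^-1 : R, x))
  <-> strictly_convex X.
Proof.
have half_ge0 : 0 <= 2^-1 :> R by rewrite invr_ge0.
split=> [oup x y x1 y1 xy|scX x x2].
  rewrite ltNge; apply/negP => mid_ge1.
  have mid1 : `|2^-1 *: (x + y)| = 1.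
    apply/eqP; rewrite eq_le mid_ge1 andbT normrZ ger0_norm //.
    by have := ler_normD x y; rewrite x1 y1; lra.
  (* [(1/2, m)] is the midpoint of [(1/2, x / 2)] and [(1/2, y / 2)]; the
     order unit property is tested on the first of these. *)
  pose m : X := 2^-1 *: (2^-1 *: (x + y)).
  have m2 : `|m| = 2^-1 by rewrite /m normrZ mid1 mulr1 ger0_norm.
  have x2 : `|2^-1 *: x| = 2^-1 by rewrite normrZ x1 mulr1 ger0_norm.
  have y2 : `|2^-1 *: y| = 2^-1 by rewrite normrZ y1 mulr1 ger0_norm.
  have [_ /(_ ((2^-1 : R), 2^-1 *: x))] := oup m m2.
  have -> : ou_norm (((2^-1 : R), 2^-1 *: x) : tilde X) = 1.
    by rewrite ou_norm_tilde /l1_norm /= x2 ger0_norm //; field.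
  have twom : 2 *: m = 2^-1 *: x + 2^-1 *: y.
    by rewrite /m [LHS]scalerA mulfV ?scale1r ?scalerDr // pnatr_eq0.
  case.
    exists 2 => //; split; rewrite /= /tilde_cone /=.
      change (`|2 *: m + 2^-1 *: x| <= 2 * 2^-1 + 2^-1 :> R).
      apply: le_trans (ler_normD _ _) _.
      by rewrite normrZ m2 x2 ger0_norm.
    change (`|2 *: m - 2^-1 *: x| <= 2 * 2^-1 - 2^-1 :> R).
    by rewrite twom [_ + _ *: y]addrC addrK y2; lra.
  move=> _; rewrite /= /tilde_cone /= => h.
  have {}h : `|1 *: m - 2^-1 *: x| <= 1 * 2^-1 - 2^-1 := h.
  rewrite mul1r subrr normr_le0 scale1r subr_eq0 in h.
  have half_neq0 : 2^-1 != 0 :> R by rewrite invr_eq0 pnatr_eq0.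
  move: h twom => /eqP ->; rewrite [2 *: _]scaler_nat mulr2n => /addrI.
  by move=> /(scalerI half_neq0) /eqP; apply/negP.
have u_cone : ous_cone (((2^-1 : R), x) : tilde X).
  by rewrite /= /tilde_cone /= x2.
split=> // v [l l0 /(tilde_boundary_ray _ _ _ _ _ scX x2 l0) vE].
have norm_v : ou_norm v = 2 * `|v.1|.
  rewrite ou_norm_tilde /l1_norm.
  have -> : v.2 = (2 * v.1) *: x by rewrite {1}vE.
  by rewrite normrZ x2 normrM ger0_norm //; field.
(* Both vectors are multiples of the boundary point, by [2 * (`|v.1| + v.1)]
   and [2 * (`|v.1| - v.1)]. *)
rewrite norm_v; split; rewrite {2}vE.
  rewrite -scalerDl; apply: ous_coneZ => //.
  by have := ler_norm (- v.1); rewrite normrN; lra.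
rewrite -scalerBl; apply: ous_coneZ => //.
by have := ler_norm v.1; lra.
Qed.
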